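(* Let $R$ be a graded principal ideal domain with $R \neq R_0$ and let $M$ be a finitely generated graded $R$-module. Then $M$ admits a graded elementary divisor decomposition over $R$, and the signatures of all such graded decompositions of $M$ coincide.
   Context: $\mathbb{N}$ contains $0$; all gradings are over $\mathbb{N}$. A graded ring is a ring $R$ together with additive subgroups $(R_n)_{n \in \mathbb{N}}$ such that $(R,+)$ is the internal direct sum of the $R_n$ and $R_n \cdot R_m \subset R_{n+m}$ for all $n,m \in \mathbb{N}$. Elements of $R_n$ are called homogeneous of degree $n$; an element is homogeneous if it is homogeneous of some degree. A graded principal ideal domain is a graded ring that is a domain and in which every homogeneous ideal (i.e., every ideal generated by homogeneous elements) is generated by a single element. A graded module over a graded ring $R$ is an $R$-module $M$ with additive subgroups $(M_n)_{n \in \mathbb{N}}$ such that $(M,+)$ is the internal direct sum of the $M_n$ and $R_n \cdot M_m \subset M_{n+m}$ for all $n,m \in \mathbb{N}$. Homomorphisms of graded $R$-modules are $R$-linear maps that preserve the grading. For $n \in \mathbb{N}$, $\Sigma^n M$ is the shifted graded module with $(\Sigma^n M)_j = M_{j-n}$ for $j \geq n$ and $(\Sigma^n M)_j = 0$ for $j<n$. Direct sums are graded degreewise, and for a submodule $M' \subset M$ generated by homogeneous elements, $M/M'$ is graded by $(M_n/(M' \cap M_n))_{n \in \mathbb{N}}$. A graded elementary divisor decomposition of a graded $R$-module $M$ over $R$ is an isomorphism of graded $R$-modules $$M \cong \bigoplus_{j=1}^N \Sigma^{n_j} R/(f_j)$$ with $N \in \mathbb{N}$, degrees $n_1,\dots,n_N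 \in \mathbb{N}$, and homogeneous elements $f_1,\dots,f_N \in R$ with $f_j \mid f_{j+1}$ for all $j \in \{1,\dots,N-1\}$; here the right-hand side carries the canonical grading. The signature of such a decomposition is the multiset of all pairs $(n_j, R^\times \cdot f_j)$ with $j \in \{1,\dots,N\}$, where $R^\times$ is the group of units of $R$.
   Formalization: Uniqueness of signatures is stated only for decompositions in which no f_j is a unit (zero summands R/(1) of any degree could otherwise be added, changing the signature); existence is proved with all f_j non-units. *)

(* Defs.v *)
From HB Require Import structures.
From mathcomp Require Import all_boot all_order all_algebra.
From mathcomp Require Import ring_quotient generic_quotient.
From mathcomp Require Import finmap multiset.
From mathcomp Require Import boolp classical_sets.

Set Implicit Arguments.
Unset Strict Implicit.
Unset Printing Implicit Defensive.

Import GRing.Theory.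

Local Open Scope classical_set_scope.
Local Open Scope quotient_scope.
Local Open Scope ring_scope.

(* A family [G : nat -> set V] assigns to each degree its homogeneous part. *)

Definition subgroup (V : zmodType) (A : set V) : Prop :=
  A 0 /\ forall x y, A x -> A y -> A (x - y).

(* [V] is the internal direct sum of the subgroups [G n]: every element is a
   finite sum of homogeneous elements, and the only such expression of [0]
   is the trivial one. *)
Definition internal_direct_sum (V : zmodType) (G : nat -> set V) : Prop :=
  [/\ forall n, subgroup (G n),
      forall x, exists (N : nat) (c : nat -> V),
        (forall n, G n (c n)) /\ x = \sum_(n < N) c n
    & forall (N : nat) (c : nat -> V), (forall n, G n (c n)) ->
        \sum_(n < N) c n = 0 -> forall n, (n < N)%N -> c n = 0].

Definition graded_ring (R : comNzRingType) (RG : nat -> set R) : Prop :=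
  internal_direct_sum RG /\
  forall n m x y, RG n x -> RG m y -> RG (n + m)%N (x * y).

Definition graded_module (R : comNzRingType) (RG : nat -> set R)
    (M : lmodType R) (MG : nat -> set M) : Prop :=
  internal_direct_sum MG /\
  forall n m a x, RG n a -> MG m x -> MG (n + m)%N (a *: x).

Definition homogeneous (V : zmodType) (G : nat -> set V) : set V :=
  [set x | exists n, G n x].

Definition is_ideal (R : comNzRingType) (I : set R) : Prop :=
  subgroup I /\ forall a x, I x -> I (a * x).

Definition ideal_generated (R : comNzRingType) (S : set R) : set R :=
  smallest (@is_ideal R) S.

Definition homogeneous_ideal (R : comNzRingType) (RG : nat -> set R)
    (I : set R) : Prop :=
  exists2 S : set R, S `<=` homogeneous RG & I = ideal_generated S.

Definition graded_PID (R : idomainType) (RG : nat -> set R) : Prop :=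
  graded_ring RG /\
  forall I, homogeneous_ideal RG I ->
    exists g : R, I = ideal_generated [set g].

Definition finitely_generated (R : comNzRingType) (M : lmodType R) : Prop :=
  exists (k : nat) (e : 'I_k -> M),
    forall x, exists c : 'I_k -> R, x = \sum_(i < k) c i *: e i.

Definition divides (R : comNzRingType) (f g : R) : Prop :=
  exists a, g = a * f.

Section CyclicModule.
Variables (R : comNzRingType) (f : R).

Definition principal_ideal : {pred R} := fun x => `[< divides f x >].

Lemma principal_idealP (x : R) : reflect (divides f x) (x \in principal_ideal).
Proof. exact: asboolP. Qed.

Lemma principal_ideal_zmod_closed : zmod_closed principal_ideal.
Proof.
split=> [|_ _ /principal_idealP[a ->] /principal_idealP[b ->]];
  apply/principal_idealP; first by exists 0; rewrite mul0r.
by exists (a - b); rewrite mulrBl.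
Qed.

HB.instance Definition _ :=
  GRing.isZmodClosed.Build R principal_ideal principal_ideal_zmod_closed.

(* The library's ring quotients only cover proper ideals, while [f] may be a
   unit here; so the quotient group is given its module structure directly. *)
Definition cyclic_module : Type := Quotient.quot principal_ideal.

HB.instance Definition _ := GRing.Zmodule.on cyclic_module.
HB.instance Definition _ := EqQuotient.on cyclic_module.

Definition cyclic_proj (x : R) : cyclic_module :=
  \pi_(Quotient.quot principal_ideal) x.

Lemma cyclic_projE (x y : R) :
  cyclic_proj x = cyclic_proj y <-> divides f (x - y).
Proof.
rewrite /cyclic_proj; split=> [/eqP|h].
  by rewrite -Quotient.idealrBE => /principal_idealP.
by apply/eqP; rewrite -Quotient.idealrBE; apply/principal_idealP.
Qed.

Lemma cyclic_projP (q : cyclic_module) : exists x, cyclic_proj x = q.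
Proof. by exists (repr q); rewrite /cyclic_proj reprK. Qed.

Lemma cyclic_projD (x y : R) :
  cyclic_proj (x + y) = cyclic_proj x + cyclic_proj y.
Proof. by rewrite /cyclic_proj Quotient.pi_add. Qed.

Definition cyclic_scale (a : R) (q : cyclic_module) : cyclic_module :=
  cyclic_proj (a * repr q).

Lemma cyclic_scaleE (a x : R) :
  cyclic_scale a (cyclic_proj x) = cyclic_proj (a * x).
Proof.
have [b Eb] : divides f (repr (cyclic_proj x) - x).
  by apply/cyclic_projE; rewrite /cyclic_proj reprK.
by apply/cyclic_projE; exists (a * b); rewrite -mulrBr Eb mulrA.
Qed.

Lemma cyclic_scaleA (a b : R) (q : cyclic_module) :
  cyclic_scale a (cyclic_scale b q) = cyclic_scale (a * b) q.
Proof. by case: (cyclic_projP q) => x <-; rewrite !cyclic_scaleE mulrA. Qed.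

Lemma cyclic_scale1 : left_id 1 cyclic_scale.
Proof.
by move=> q; case: (cyclic_projP q) => x <-; rewrite cyclic_scaleE mul1r.
Qed.

Lemma cyclic_scaleDr : right_distributive cyclic_scale +%R.
Proof.
move=> a p q; case: (cyclic_projP p) => x <-; case: (cyclic_projP q) => y <-.
by rewrite -cyclic_projD !cyclic_scaleE mulrDr cyclic_projD.
Qed.

Lemma cyclic_scaleDl (q : cyclic_module) :
  {morph cyclic_scale^~ q : a b / a + b}.
Proof.
move=> a b; case: (cyclic_projP q) => x <-.
by rewrite !cyclic_scaleE mulrDl cyclic_projD.
Qed.

HB.instance Definition _ := GRing.Zmodule_isLmodule.Build R cyclic_module
  cyclic_scaleA cyclic_scale1 cyclic_scaleDr cyclic_scaleDl.

(* [R_n / ((f) \cap R_n)], viewed inside [R / (f)] *)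
Definition cyclic_grading (RG : nat -> set R) (n : nat) : set cyclic_module :=
  [set cyclic_proj x | x in RG n].

End CyclicModule.

Arguments cyclic_grading {R} f RG n.

Definition shift_grading (V : zmodType) (k : nat) (G : nat -> set V) (j : nat) :
    set V :=
  if (k <= j)%N then G (j - k)%N else [set 0].

Section DirectSum.
Variables (R : comNzRingType) (I : finType) (F : I -> lmodType R).

(* The index type is finite, so the direct sum is the full product. *)
Definition direct_sum : Type := forall i, F i.

HB.instance Definition _ := gen_eqMixin direct_sum.
HB.instance Definition _ := gen_choiceMixin direct_sum.

Implicit Types x y z : direct_sum.

Definition dsum_zero : direct_sum := fun i => 0.
Definition dsum_opp x : direct_sum := fun i => - x i.
Definition dsum_add x y : direct_sum := fun i => x i + y i.
Definition dsum_scale (a : R) x : direct_sum := fun i => a *: x i.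

Lemma dsum_addA : associative dsum_add.
Proof. by move=> x y z; apply: functional_extensionality_dep => i;
  exact: addrA. Qed.
Lemma dsum_addC : commutative dsum_add.
Proof. by move=> x y; apply: functional_extensionality_dep => i;
  exact: addrC. Qed.
Lemma dsum_add0 : left_id dsum_zero dsum_add.
Proof. by move=> x; apply: functional_extensionality_dep => i;
  exact: add0r. Qed.
Lemma dsum_addN : left_inverse dsum_zero dsum_opp dsum_add.
Proof. by move=> x; apply: functional_extensionality_dep => i;
  exact: addNr. Qed.

HB.instance Definition _ := GRing.isZmodule.Build direct_sum
  dsum_addA dsum_addC dsum_add0 dsum_addN.

Lemma dsum_scaleA a b x : dsum_scale a (dsum_scale b x) = dsum_scale (a * b) x.
Proof. by apply: functional_extensionality_dep => i;
  exact: scalerA. Qed.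
Lemma dsum_scale1 : left_id 1 dsum_scale.
Proof. by move=> x; apply: functional_extensionality_dep => i;
  exact: scale1r. Qed.
Lemma dsum_scaleDr : right_distributive dsum_scale +%R.
Proof. by move=> a x y; apply: functional_extensionality_dep => i;
  exact: scalerDr. Qed.
Lemma dsum_scaleDl x : {morph dsum_scale^~ x : a b / a + b}.
Proof. by move=> a b; apply: functional_extensionality_dep => i;
  exact: scalerDl. Qed.

HB.instance Definition _ := GRing.Zmodule_isLmodule.Build R direct_sum
  dsum_scaleA dsum_scale1 dsum_scaleDr dsum_scaleDl.

Definition dsum_grading (FG : forall i, nat -> set (F i)) (n : nat) :
    set direct_sum :=
  [set x | forall i, FG i n (x i)].

End DirectSum.

Definition graded_hom (R : comNzRingType) (M N : lmodType R)
    (MG : nat -> set M) (NG : nat -> set N) (f : {linear M -> N}) : Prop :=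
  forall n x, MG n x -> NG n (f x).

Definition graded_isomorphic (R : comNzRingType) (M N : lmodType R)
    (MG : nat -> set M) (NG : nat -> set N) : Prop :=
  exists (f : {linear M -> N}) (g : {linear N -> M}),
    [/\ graded_hom MG NG f, graded_hom NG MG g, cancel f g & cancel g f].

(* The graded module [\bigoplus_j \Sigma^(n j) R / (f j)]. *)
Definition divisor_sum (R : comNzRingType) (N : nat) (f : 'I_N -> R) :
    lmodType R :=
  direct_sum (fun j => cyclic_module (f j) : lmodType R).

Definition divisor_sum_grading (R : comNzRingType) (RG : nat -> set R)
    (N : nat) (n : 'I_N -> nat) (f : 'I_N -> R) : nat -> set (divisor_sum f) :=
  dsum_grading (fun j => shift_grading (n j) (cyclic_grading (f j) RG)).

Arguments divisor_sum_grading {R} RG {N} n f.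

Record graded_edd (R : idomainType) (RG : nat -> set R)
    (M : lmodType R) (MG : nat -> set M) := GradedEdd {
  edd_size : nat;
  edd_degree : 'I_edd_size -> nat;
  edd_divisor : 'I_edd_size -> R;
  edd_homogeneous : forall j, homogeneous RG (edd_divisor j);
  edd_chain : forall i j : 'I_edd_size, j = i.+1 :> nat ->
    divides (edd_divisor i) (edd_divisor j);
  edd_iso : graded_isomorphic MG (divisor_sum_grading RG edd_degree edd_divisor)
}.

Arguments edd_degree {R RG M MG} d j : rename.
Arguments edd_divisor {R RG M MG} d j : rename.

(* Summands with [f_j] a unit vanish and can be added freely in front, with
   any degree; signatures are unique only among decompositions without them. *)
Definition edd_nonunit (R : idomainType) (RG : nat -> set R)
    (M : lmodType R) (MG : nat -> set M) (d : graded_edd RG MG) : Prop :=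
  forall j, edd_divisor d j \isn't a GRing.unit.

Definition unit_class (R : idomainType) (f : R) : set R :=
  [set u * f | u in [set u | u \is a GRing.unit]].

Definition edd_signature (R : idomainType) (RG : nat -> set R)
    (M : lmodType R) (MG : nat -> set M) (d : graded_edd RG MG) :
    multiset (nat * set R)%type :=
  seq_mset [seq (edd_degree d j, unit_class (edd_divisor d j))
           | j <- enum 'I_(edd_size d)].

(* Main.v *)
(* The ideal of elements of positive degree is generated by one homogeneous
   element [t], and the nonzero elements of [R_0] are units. Hence [R] behaves
   like a graded discrete valuation ring: of two nonzero homogeneous elements the
   one of lower degree divides the other.

   Existence is Gaussian elimination on a finite family of homogeneous generators
   [e]. Among the homogeneous relations between the generators not yet split off,
   pick a nonzero coefficient of lowest degree, say [a] in front of [e i]. It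
   divides every coefficient of every such relation, so replacing [e i] by
   [\sum_j (a_j / a) e_j] splits off a summand [R / (a)]. Starting with a minimal
   number of generators, no divisor is a unit.

   Uniqueness: for a property [D] of ring elements inherited by divisors, the
   transition matrices between two decompositions restrict to mutually inverse
   matrices on the generators of degree [d] whose divisors satisfy [D], so their
   number is an invariant of the module. Taking for [D] "divides [g]" and
   "strictly divides [g]", the difference of the two numbers is the multiplicity of
   [(d, R^* g)] in the signature. *)
From HB Require Import structures.
Require Import Defs.
From mathcomp Require Import all_boot all_order all_algebra.
From mathcomp Require Import zify fraction perm.
From mathcomp Require Import finmap multiset.
From mathcomp Require Import boolp classical_sets.

Set Implicit Arguments.
Unset Strict Implicit.
Unset Printing Implicit Defensive.

Import GRing.Theory.

Local Open Scope ring_scope.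

(** * Homogeneous components *)

Lemma subgroupD (V : zmodType) (A : set V) x y :
  subgroup A -> A x -> A y -> A (x + y).
Proof.
move=> [A0 AB] Ax Ay; rewrite -[y]opprK; apply: (AB) => //.
by rewrite -sub0r; apply: (AB).
Qed.

Lemma subgroup_sum (V : zmodType) (A : set V) (I : Type) (r : seq I)
    (P : pred I) (F : I -> V) :
  subgroup A -> (forall i, P i -> A (F i)) -> A (\sum_(i <- r | P i) F i).
Proof. by move=> sA AF; apply: big_ind => //= [|x y]; [case: sA|exact: subgroupD]. Qed.

Section Components.
Variables (V : zmodType) (G : nat -> set V).
Hypothesis dG : internal_direct_sum G.

Lemma grading_subgroup n : subgroup (G n). Proof. by case: dG. Qed.

Lemma grading0 n : G n 0. Proof. by case: (grading_subgroup n). Qed.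

Lemma sum_ord_support (c : nat -> V) N L :
  (forall n, (N <= n)%N -> c n = 0) -> (N <= L)%N ->
  \sum_(n < N) c n = \sum_(n < L) c n.
Proof.
move=> c0 NL; rewrite (big_ord_widen _ _ NL) big_mkcond /=.
by apply: eq_bigr => i _; case: ltnP => // /c0.
Qed.

(** The family given by the direct sum is arbitrary from index [N] on; cutting it off there gives
    the finite support needed for uniqueness. *)
Lemma component_exists x : exists c : nat -> V, (forall n, G n (c n)) /\
  exists N, (forall n, (N <= n)%N -> c n = 0) /\ x = \sum_(n < N) c n.
Proof.
case: dG => _ /(_ x)[N [c [Gc ->]]] _.
exists (fun n => if (n < N)%N then c n else 0); split.
  by move=> n; case: ifP => // _; apply: grading0.
exists N; split; first by move=> n; rewrite leqNgt => /negPf ->.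
by apply: eq_bigr => i _; rewrite ltn_ord.
Qed.

Definition component x : nat -> V := projT1 (cid (component_exists x)).

Lemma component_in x n : G n (component x n).
Proof. by rewrite /component; case: cid => c [] /=. Qed.

Lemma component_sum x : exists N, (forall n, (N <= n)%N -> component x n = 0) /\
  forall L, (N <= L)%N -> x = \sum_(n < L) component x n.
Proof.
rewrite /component; case: cid => c [/= _ [N [c0 E]]]; exists N; split=> // L NL.
by rewrite {1}E; apply: sum_ord_support.
Qed.

Lemma component_unique x c N : (forall n, G n (c n)) ->
  (forall n, (N <= n)%N -> c n = 0) -> x = \sum_(n < N) c n ->
  forall n, component x n = c n.
Proof.
move=> Gc c0 Ec n; have [K [d0 Ed]] := component_sum x.
case: dG => sG _ uG; pose L := maxn N K.
case: (ltnP n L) => [nL|]; last first.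
  by rewrite geq_max => /andP[nN nK]; rewrite c0 ?d0.
apply/eqP; rewrite -subr_eq0; apply/eqP.
apply: (uG L (fun k => component x k - c k)) => //.
  by move=> k; apply: (proj2 (sG k)) => //; apply: component_in.
rewrite sumrB -Ed ?leq_maxr // -(sum_ord_support c0) ?leq_maxl //.
by rewrite -Ec subrr.
Qed.

Lemma component0 n : component 0 n = 0.
Proof.
by apply: (@component_unique 0 (fun=> 0) 0) => [k||]; rewrite ?big_ord0 //;
  apply: grading0.
Qed.

Lemma componentD x y n : component (x + y) n = component x n + component y n.
Proof.
have [K [x0 Ex]] := component_sum x; have [L [y0 Ey]] := component_sum y.
apply: (@component_unique _ (fun k => component x k + component y k) (maxn K L)).
- by move=> k; apply: subgroupD; [exact: grading_subgroup|exact: component_in..].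
- by move=> k; rewrite geq_max => /andP[? ?]; rewrite x0 ?y0 ?addr0.
by rewrite big_split /= -Ex ?leq_maxl -?Ey ?leq_maxr.
Qed.

Lemma componentB x y n : component (x - y) n = component x n - component y n.
Proof. by apply/eqP; rewrite eq_sym subr_eq -componentD subrK. Qed.

Lemma component_big (I : Type) (r : seq I) (P : pred I) (F : I -> V) n :
  component (\sum_(i <- r | P i) F i) n = \sum_(i <- r | P i) component (F i) n.
Proof.
apply: (big_morph (fun x => component x n)) => [x y|]; first exact: componentD.
exact: component0.
Qed.

Lemma component_homogeneous p x n :
  G p x -> component x n = if n == p then x else 0.
Proof.
move=> Gx; apply: (@component_unique _ (fun k => if k == p then x else 0) p.+1).
- by move=> k; case: eqP => [->|_] //; apply: grading0.
- by move=> k pk; rewrite gtn_eqF.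
rewrite big_ord_recr /= eqxx big1 ?add0r // => i _.
by rewrite ltn_eqF ?ltn_ord.
Qed.

Lemma component_id p x : G p x -> component x p = x.
Proof. by move/component_homogeneous ->; rewrite eqxx. Qed.

Lemma component_inj x y : component x =1 component y -> x = y.
Proof.
have [N [_ Ex]] := component_sum x; have [L [_ Ey]] := component_sum y => E.
rewrite (Ex _ (leq_maxl N L)) [RHS](Ey _ (leq_maxr N L)).
by apply: eq_bigr => i _.
Qed.

Lemma component_concentrated p x : (forall n, n != p -> component x n = 0) -> G p x.
Proof.
move=> x0; have -> : x = component x p; last exact: component_in.
apply: component_inj => n; rewrite (component_homogeneous n (component_in x p)).
by case: eqP => [->|/eqP/x0].
Qed.

Lemma homogeneous_degree_inj p q x : G p x -> G q x -> x != 0 -> p = q.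
Proof.
move=> Gp Gq; have := component_homogeneous q Gp.
rewrite (component_id Gq); case: eqP => // _ -> /eqP; by [].
Qed.

End Components.

(** After expanding [a], its [i]-th term lands in degree [i + p], so only [i = n - p] can
    contribute. *)
Lemma component_scale (R : comNzRingType) (RG : nat -> set R) (M : lmodType R)
    (MG : nat -> set M) (dR : internal_direct_sum RG) (dM : internal_direct_sum MG)
    a x p n :
  graded_module RG MG -> MG p x ->
  component dM (a *: x) n = if (p <= n)%N then component dR a (n - p) *: x else 0.
Proof.
move=> [_ MGS] Mx; have [N [a0 /(_ _ (leqnn N)) Ea]] := component_sum dR a.
rewrite {1}Ea scaler_suml component_big.
under eq_bigr => i _ do
  rewrite (component_homogeneous dM n (MGS _ _ _ _ (component_in dR a i) Mx)).
rewrite -big_mkcond /=; case: leqP => [pn|np]; last first.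
  rewrite big_pred0 // => i; apply/eqP => E.
  by move: np; rewrite E ltnNge leq_addl.
case: (ltnP (n - p) N) => nN; last first.
  rewrite (a0 _ nN) scale0r big_pred0 // => i; apply/eqP => E.
  by move: nN; rewrite E addnK leqNgt ltn_ord.
rewrite (big_pred1 (Ordinal nN)) // => i.
by apply/eqP/eqP => [E | -> /=]; [apply/val_inj; rewrite /= E addnK|rewrite subnK].
Qed.

(** * Graded domains and graded principal ideal domains *)

Section GradedDomain.
Variables (R : idomainType) (RG : nat -> set R).
Hypothesis gR : graded_ring RG.

Let dR : internal_direct_sum RG := proj1 gR.
Local Notation comp := (component dR).

Lemma graded_regular : @graded_module R RG R^o RG.
Proof. by case: gR. Qed.

Lemma component_mulr a b p n : RG p b ->
  comp (a * b) n = if (p <= n)%N then comp a (n - p) * b else 0.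
Proof. exact: (@component_scale R RG R^o RG dR dR a b p n graded_regular). Qed.

(** The hypothesis leaves [(p, q)] as the only pair contributing to degree [p + q]. It holds for the
    lowest degrees of two factors and also for the highest. *)
Lemma component_mul_extremal a b p q :
  (forall j, (j <= p + q)%N -> j != q -> comp a (p + q - j) = 0 \/ comp b j = 0) ->
  comp (a * b) (p + q) = comp a p * comp b q.
Proof.
move=> h; have [N [b0 Eb]] := component_sum dR b.
have {}Eb := Eb (maxn N q.+1) (leq_maxl _ _).
rewrite {1}Eb mulr_sumr component_big.
have qN : (q < maxn N q.+1)%N by rewrite leq_max leqnn orbT.
rewrite (bigD1 (Ordinal qN)) //= big1 ?addr0.
  by rewrite (component_mulr _ _ (component_in dR b q)) leq_addl addnK.
move=> j jq; rewrite (component_mulr _ _ (component_in dR b j)).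
by case: leqP => // jpq; case: (h j jpq jq) => ->; rewrite ?mul0r ?mulr0.
Qed.

Lemma component0_mul a b : comp (a * b) 0 = comp a 0 * comp b 0.
Proof.
by rewrite -[in LHS](addn0 0%N) component_mul_extremal // => j; rewrite leqn0 => ->.
Qed.

(** Comparing degrees in [1 * y = y] for homogeneous [y] shows that the degree-0 part of 1 fixes
    [y]. This part is thus itself an identity. *)
Lemma grading1 : RG 0%N 1.
Proof.
have e1 y : comp 1 0 * y = y.
  apply: (component_inj (dG := dR)) => n.
  rewrite mulrC (component_mulr _ _ (component_in dR 1 0)) leq0n subn0.
  have := component_mulr 1 n (component_in dR y n).
  by rewrite leqnn subnn mul1r (component_id _ (component_in dR y n)) mulrC.
by rewrite -(e1 1) mulr1; apply: component_in.
Qed.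

Lemma nonzero_component a : a != 0 -> exists n, comp a n != 0.
Proof.
move=> a0; apply/not_existsP => h; case/eqP: a0.
apply: (component_inj (dG := dR)) => n; rewrite component0.
by apply/eqP/negPn/negP/h.
Qed.

Lemma lowest_component a : a != 0 ->
  exists p, comp a p != 0 /\ forall n, (n < p)%N -> comp a n = 0.
Proof.
move=> /nonzero_component ex; case: (ex_minnP ex) => p ap pm; exists p; split=> // n np.
by apply/eqP/negPn/negP => /pm; rewrite leqNgt np.
Qed.

Lemma highest_component a : a != 0 ->
  exists p, comp a p != 0 /\ forall n, (p < n)%N -> comp a n = 0.
Proof.
move=> /nonzero_component ex; have [N [a0 _]] := component_sum dR a.
have bd n : comp a n != 0 -> (n <= N)%N.
  by apply: contraR; rewrite -ltnNge => /ltnW /a0 /eqP.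
case: (ex_maxnP ex bd) => p ap pm; exists p; split=> // n np.
by apply/eqP/negPn/negP => /pm; rewrite leqNgt np.
Qed.

(* The products of the lowest components and of the highest components are both
   nonzero components of [a * b], hence have the same degree. *)
Lemma homogeneous_divisor a b d : RG d (a * b) -> a * b != 0 ->
  exists p q, [/\ (p + q = d)%N, RG p a & RG q b].
Proof.
move=> Gab ab0; have /norP[a0 b0] : ~~ ((a == 0) || (b == 0)) by rewrite -mulf_eq0.
have [p [ap pm]] := lowest_component a0; have [q [bq qm]] := lowest_component b0.
have [p' [ap' pM]] := highest_component a0; have [q' [bq' qM]] := highest_component b0.
have deg r s : comp a r != 0 -> comp b s != 0 ->
    comp (a * b) (r + s) = comp a r * comp b s -> (r + s)%N = d.
  move=> ar bs; rewrite (component_homogeneous _ _ Gab); case: eqP => // _ /esym/eqP.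
  by rewrite mulf_eq0 (negPf ar) (negPf bs).
have E : (p + q)%N = d.
  apply: deg => //; apply: component_mul_extremal => j jpq.
  by rewrite neq_ltn => /orP[/qm ->|qj];
    [right|left; apply: pm; rewrite ltn_subLR // addnC ltn_add2r].
have E' : (p' + q')%N = d.
  apply: deg => //; apply: component_mul_extremal => j jpq.
  by rewrite neq_ltn => /orP[jq|/qM ->];
    [left; apply: pM; rewrite ltn_subRL addnC ltn_add2l|right].
have pp : (p <= p')%N by rewrite leqNgt; apply: contra ap => /pM ->.
have qq : (q <= q')%N by rewrite leqNgt; apply: contra bq => /qM ->.
have [Ep Eq] : p' = p /\ q' = q by split; lia.
exists p, q; split=> //; apply: (component_concentrated (dG := dR)) => n;
  rewrite neq_ltn => /orP[].
- exact: pm.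
- by rewrite -Ep; apply: pM.
- exact: qm.
- by rewrite -Eq; apply: qM.
Qed.

End GradedDomain.

Lemma ideal_generated_ideal (R : comNzRingType) (S : set R) :
  is_ideal (ideal_generated S).
Proof.
split; first split.
- by move=> I [[[I0 _] _] _].
- by move=> x y Sx Sy I II; case: (II) => [[[_ IB] _] _]; apply: IB;
    [apply: Sx|apply: Sy].
- by move=> a x Sx I II; case: (II) => [[_ IZ] _]; apply: IZ; apply: Sx.
Qed.

Lemma ideal_generated_in (R : comNzRingType) (S : set R) x :
  S x -> ideal_generated S x.
Proof. by move=> Sx I [_]; apply. Qed.

Lemma ideal_generated_min (R : comNzRingType) (S I : set R) x :
  is_ideal I -> (forall y, S y -> I y) -> ideal_generated S x -> I x.
Proof. by move=> iI SI; apply; split. Qed.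

Lemma divides_ideal (R : comNzRingType) (g : R) : is_ideal [set x | divides g x]%classic.
Proof.
split; first split => [|_ _ [a ->] [b ->]] /=.
- by exists 0; rewrite mul0r.
- by exists (a - b); rewrite mulrBl.
- by move=> c _ [a ->] /=; exists (c * a); rewrite mulrA.
Qed.

Lemma principal_generatedP (R : comNzRingType) (g x : R) :
  ideal_generated [set g]%classic x <-> divides g x.
Proof.
split=> [|[a ->]].
  apply: (ideal_generated_min (divides_ideal g)) => _ ->.
  by exists 1; rewrite mul1r.
by apply: (proj2 (ideal_generated_ideal _)); apply: ideal_generated_in.
Qed.

(** * Divisibility between homogeneous elements *)

Section GradedPID.
Variables (R : idomainType) (RG : nat -> set R).
Hypothesis pR : graded_PID RG.
Hypothesis RG0 : RG 0%N <> [set: R]%classic.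

Let gR : graded_ring RG := proj1 pR.
Let dR : internal_direct_sum RG := proj1 gR.
Local Notation comp := (component dR).

Lemma homogeneous_ideal_generator (S : set R) :
  (forall x, S x -> homogeneous RG x) ->
  exists g, forall x, ideal_generated S x <-> divides g x.
Proof.
move=> hS; have [|g Eg] := proj2 pR (ideal_generated S); first by exists S.
by exists g => x; rewrite Eg principal_generatedP.
Qed.

Lemma nonzero_positive_degree : exists n x, [/\ (0 < n)%N, RG n x & x != 0].
Proof.
apply: contrapT => h; apply: RG0; apply/seteqP; split=> // x _.
apply: (component_concentrated (dG := dR)) => n n0; apply/eqP/negPn/negP => xn.
by apply: h; exists n, (comp x n); rewrite lt0n; split=> //; apply: component_in.
Qed.

(** A generator [t] of the ideal spanned by the elements of positive degree divides a nonzero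
    homogeneous element, which exists as $R \neq R_0$; hence [t] is homogeneous. *)
Lemma irrelevant_ideal_generator : exists q t, [/\ (0 < q)%N, RG q t, t != 0
  & forall n x, (0 < n)%N -> RG n x -> divides t x].
Proof.
pose S : set R := [set x | exists2 n, (0 < n)%N & RG n x]%classic.
have [|t St] := @homogeneous_ideal_generator S; first by move=> x [n _ ?]; exists n.
have [n [x [n0 Gx x0]]] := nonzero_positive_degree.
have [a Ex] : divides t x by apply/St; apply: ideal_generated_in; exists n.
rewrite Ex in Gx x0; have [p [q [_ _ Gt]]] := homogeneous_divisor gR Gx x0.
have t0 : t != 0 by apply: contra x0 => /eqP ->; rewrite mulr0.
exists q, t; split=> //; last first.
  by move=> m y m0 Gy; apply/St; apply: ideal_generated_in; exists m.
(* In degree 0, [t] would equal its degree-0 component, which vanishes on the whole ideal. *)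
rewrite lt0n; apply: contra t0 => /eqP q0; rewrite q0 in Gt.
have /St : divides t t by exists 1; rewrite mul1r.
rewrite -{2}(component_id dR Gt) => tS; apply/eqP.
apply: (@ideal_generated_min _ S [set y | comp y 0 = 0]%classic _ _ _ tS).
- split; first split=> [|y z y0 z0] /=; first exact: component0.
    by rewrite componentB y0 z0 subr0.
  by move=> c y y0 /=; rewrite component0_mul y0 mulr0.
by move=> y [m m0 Gy] /=; rewrite (component_homogeneous dR 0 Gy) ltn_eqF.
Qed.

(** Let [h] generate $(a, t)$. It divides [a], so it has degree 0, and in [t = c * h] the factor [c]
    has positive degree, whence [c = x * t]. Cancelling [t] gives [x * h = 1], so 1 lies in $(a,
    t)$, and in degree 0 only multiples of [a] survive. *)
Lemma degree0_inverse a : RG 0%N a -> a != 0 -> exists2 c, RG 0%N c & c * a = 1.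
Proof.
move=> Ga a0; have [q [t [q0 Gt t0 tmin]]] := irrelevant_ideal_generator.
have [|h Sh] := @homogeneous_ideal_generator [set a; t]%classic.
  by move=> _ [->|->]; [exists 0%N|exists q].
have [b Eb] : divides h a by apply/Sh; apply: ideal_generated_in; left.
have [c Ec] : divides h t by apply/Sh; apply: ideal_generated_in; right.
have Gb : RG 0%N (b * h) by rewrite -Eb.
rewrite {1}Eb in a0; have [p [r [pr0 _ Gh]]] := homogeneous_divisor gR Gb a0.
move/eqP: pr0 Gh; rewrite addn_eq0 => /andP[_ /eqP->] Gh.
have h0 : h != 0 by apply: contra a0 => /eqP ->; rewrite mulr0.
have Gt' := Gt; rewrite {1}Ec in t0; rewrite {1}Ec in Gt.
have [p' [r' [E Gc Gh']]] := homogeneous_divisor gR Gt t0.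
have [x Ex] : divides t c.
  apply: tmin Gc; rewrite -(addn0 p') {2}(homogeneous_degree_inj dR Gh Gh' h0).
  by rewrite E.
have I1 : ideal_generated [set a; t]%classic 1.
  apply/Sh; exists x; apply/esym/eqP.
  by rewrite -(inj_eq (mulfI t0)) mulr1 -Ec {2}Ec Ex mulrCA mulrA.
have [u Eu] : exists u, comp 1 0 = comp u 0 * a.
  apply: (@ideal_generated_min _ [set a; t]%classic
    [set y | exists u, comp y 0 = comp u 0 * a]%classic _ _ _ I1).
    split; first split=> [|y z [u Eu] [v Ev]] /=.
    - by exists 0; rewrite component0 mul0r.
    - by exists (u - v); rewrite !componentB mulrBl Eu Ev.
    - by move=> d y [u Eu] /=; exists (d * u); rewrite !(component0_mul gR) Eu mulrA.
  move=> y [->|->] /=.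
    by exists 1; rewrite (component_id dR Ga) (component_id dR (grading1 gR)) mul1r.
  by exists 0; rewrite component0 mul0r (component_homogeneous dR 0 Gt') ltn_eqF.
exists (comp u 0); first exact: component_in.
by rewrite -Eu (component_id dR (grading1 gR)).
Qed.

Lemma degree0_unit a : RG 0%N a -> a != 0 -> a \is a GRing.unit.
Proof.
move=> Ga /(degree0_inverse Ga)[c _ ca].
by apply/unitrP; exists c; rewrite [_ * c]mulrC.
Qed.

(** Induction on the degree of [a]: in degree 0 it is invertible, and in positive degree [t] can be
    divided out of both [a] and [b]. *)
Lemma homogeneous_quotient p r a b : RG p a -> a != 0 -> RG r b -> (p <= r)%N ->
  exists2 c, RG (r - p)%N c & b = c * a.
Proof.
move=> Ga a0 Gb pr.
suff [c Ec] : divides a b.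
  exists (comp c (r - p)); first exact: component_in.
  have := component_mulr gR c r Ga.
  by rewrite -Ec pr (component_id dR Gb).
have [q [t [q0 Gt t0 tmin]]] := irrelevant_ideal_generator.
elim/ltn_ind: p r a b Ga a0 Gb pr => -[|p] IH r a b Ga a0 Gb pr.
  have [c _ ca] := degree0_inverse Ga a0.
  by exists (b * c); rewrite -mulrA ca mulr1.
have quot n x : (0 < n)%N -> RG n x -> exists2 y, x = y * t & RG (n - q)%N y.
  move=> n0 Gx; have [y Ey] := tmin n x n0 Gx.
  have := component_mulr gR y n Gt; rewrite -Ey (component_id dR Gx).
  (* If [n < q] then [x = 0], and the quotient 0 lies in every degree. *)
  case: leqP => _ Ex; last by exists 0; rewrite ?mul0r //; apply: (grading0 dR).
  by exists (comp y (n - q)) => //; apply: component_in.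
have [a' Ea Ga'] := quot _ _ (ltn0Sn p) Ga.
have [b' Eb Gb'] := quot _ _ (leq_trans (ltn0Sn p) pr) Gb.
have a'0 : a' != 0 by apply: contra a0; rewrite Ea => /eqP ->; rewrite mul0r.
have [||c Ec] := IH (p.+1 - q)%N _ (r - q)%N a' b' Ga' a'0 Gb'.
- by rewrite ltn_subrL q0.
- by rewrite leq_sub2r.
by exists c; rewrite Eb Ec Ea mulrA.
Qed.

End GradedPID.

(** * Decompositions as families of generators *)

Section ElementaryBasis.
Variables (R : comNzRingType) (RG : nat -> set R).
Variables (M : lmodType R) (MG : nat -> set M).

Definition generates (N : nat) (e : 'I_N -> M) : Prop :=
  forall x, exists b : 'I_N -> R, x = \sum_(j < N) b j *: e j.

(** Describes the images of the standard generators of $\bigoplus_j \Sigma^{n_j} R/(f_j)$, so that a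
    decomposition can be handled through coefficients alone. *)
Definition elementary_basis (N : nat) (n : 'I_N -> nat) (f : 'I_N -> R)
    (e : 'I_N -> M) : Prop :=
  [/\ forall j, MG (n j) (e j), generates e, forall j, f j *: e j = 0
    & forall b : 'I_N -> R, \sum_(j < N) b j *: e j = 0 ->
        forall j, divides (f j) (b j)].

Lemma cyclic_proj0 (f : R) : cyclic_proj f 0 = 0.
Proof. by apply: (addrI (cyclic_proj f 0)); rewrite -cyclic_projD !addr0. Qed.

Lemma cyclic_projZ (f a x : R) : cyclic_proj f (a * x) = a *: cyclic_proj f x.
Proof. by rewrite -cyclic_scaleE. Qed.

(** An element goes to the classes of its coefficients; the homogeneous coefficients of the first
    hypothesis make this map preserve degrees. *)
Lemma elementary_basis_iso N (n : 'I_N -> nat) (f : 'I_N -> R) e :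
  (forall s x, MG s x -> exists2 b : 'I_N -> R,
     forall j, shift_grading (n j) RG s (b j) & x = \sum_(j < N) b j *: e j) ->
  graded_module RG MG -> elementary_basis n f e ->
  graded_isomorphic MG (divisor_sum_grading RG n f).
Proof.
move=> hcoef [dM MGS] [Ge gen fe rel].
pose lift (y : divisor_sum f) j : R := projT1 (cid (cyclic_projP (y j))).
have liftK y j : cyclic_proj (f j) (lift y j) = y j by rewrite /lift; case: cid.
(* A combination depends only on the classes of its coefficients. With the converse [projE] this
   makes [F] and [H] linear and mutually inverse. *)
have combE b c : (forall j, cyclic_proj (f j) (b j) = cyclic_proj (f j) (c j)) ->
    \sum_(j < N) b j *: e j = \sum_(j < N) c j *: e j.
  move=> bc; apply: eq_bigr => j _; case/cyclic_projE: (bc j) => a Ea.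
  by rewrite -(subrK (c j) (b j)) Ea scalerDl -scalerA fe scaler0 add0r.
pose coef x : 'I_N -> R := projT1 (cid (gen x)).
have coefE x : \sum_(j < N) coef x j *: e j = x by rewrite /coef; case: cid.
have projE b c : \sum_(j < N) b j *: e j = \sum_(j < N) c j *: e j ->
    forall j, cyclic_proj (f j) (b j) = cyclic_proj (f j) (c j).
  move=> bc j; apply/cyclic_projE; apply: (rel (fun j => b j - c j)).
  under eq_bigr => i _ do rewrite scalerBl.
  by rewrite sumrB bc subrr.
pose F x : divisor_sum f := fun j => cyclic_proj (f j) (coef x j).
pose H (y : divisor_sum f) := \sum_(j < N) lift y j *: e j.
have linF : linear F.
  move=> a x y; apply: functional_extensionality_dep => j.
  rewrite -[RHS]/(a *: F x j + F y j) /F -cyclic_projZ -cyclic_projD.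
  apply: (projE _ (fun j => a * coef x j + coef y j)).
  under [RHS]eq_bigr => i _ do rewrite scalerDl -scalerA.
  by rewrite big_split /= -scaler_sumr !coefE.
have linH : linear H.
  move=> a x y; rewrite /H scaler_sumr -big_split /=.
  under [RHS]eq_bigr => i _ do rewrite scalerA -scalerDl.
  apply: combE => j.
  by rewrite liftK cyclic_projD cyclic_projZ !liftK.
pose FL : {linear M -> divisor_sum f} :=
  HB.pack F (GRing.isLinear.Build R M (divisor_sum f) _ F linF).
pose HL : {linear divisor_sum f -> M} :=
  HB.pack H (GRing.isLinear.Build R (divisor_sum f) M _ H linH).
have FK : cancel F H.
  by move=> x; rewrite -[RHS]coefE; apply: combE => j; rewrite liftK.
have HK : cancel H F.
  move=> y; apply: functional_extensionality_dep => j; rewrite -[RHS]liftK.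
  by apply: (projE _ (lift y)); rewrite coefE.
exists FL, HL; split=> //.
- move=> s x /hcoef[b Gb Ex] j /=.
  have -> : F x j = cyclic_proj (f j) (b j) by apply: projE; rewrite coefE.
  move: (Gb j); rewrite /shift_grading; case: leqP => _ Gbj; first by exists (b j).
  by rewrite Gbj /= cyclic_proj0.
move=> s y Gy /=.
have ex j : exists c, shift_grading (n j) RG s c /\ cyclic_proj (f j) c = y j.
  move: (Gy j); rewrite /shift_grading; case: leqP => _; first by case=> c; exists c.
  by move=> ->; exists 0; rewrite cyclic_proj0.
have [b Eb] := choice ex.
rewrite /H (combE _ b); last by move=> j; rewrite liftK; case: (Eb j).
apply: subgroup_sum => [|j _]; first by case: dM.
case: (Eb j); rewrite /shift_grading; case: leqP => [ns Gbj _|_ -> _].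
  by rewrite -(subnK ns); apply: MGS.
by rewrite scale0r; case: dM => /(_ s)[].
Qed.

Lemma iso_elementary_basis N (n : 'I_N -> nat) (f : 'I_N -> R) :
  RG 0%N 1 -> (forall s, RG s 0) ->
  graded_isomorphic MG (divisor_sum_grading RG n f) ->
  exists e, elementary_basis n f e.
Proof.
move=> RG1 RG0 [F [H [_ GH FK HK]]].
pose vec (b : 'I_N -> R) : divisor_sum f := fun j => cyclic_proj (f j) (b j).
pose e j := H (vec (fun i => (i == j)%:R)).
have vecE y : exists b, y = vec b.
  have [b Eb] := choice (fun j => cyclic_projP (y j)).
  by exists b; apply: functional_extensionality_dep => j; rewrite /vec Eb.
have sumE (I : finType) (g : I -> divisor_sum f) j :
    (\sum_i g i : divisor_sum f) j = \sum_i g i j.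
  exact: (big_morph (fun y : divisor_sum f => y j)).
have combE b : \sum_(j < N) b j *: e j = H (vec b).
  under eq_bigr => j _ do rewrite -linearZ.
  rewrite -linear_sum; congr (H _); apply: functional_extensionality_dep => i.
  rewrite sumE (bigD1 i) //= big1 => [|j ji].
    rewrite -[LHS]/(_ *: cyclic_proj (f i) (i == i)%:R + _).
    by rewrite -cyclic_projZ eqxx mulr1 addr0.
  rewrite -[LHS]/(_ *: cyclic_proj (f i) (i == j)%:R).
  by rewrite -cyclic_projZ eq_sym (negPf ji) mulr0 cyclic_proj0.
exists e; split.
- move=> j; apply: GH => i; rewrite /shift_grading /vec; case: eqP => [->|_].
    by rewrite leqnn subnn; exists 1.
  rewrite mulr0n cyclic_proj0; case: ifP => // _.
  by exists 0; rewrite ?cyclic_proj0.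
- move=> x; have [b Eb] := vecE (F x); exists b.
  by rewrite combE -Eb FK.
- move=> j; have -> : f j *: e j = \sum_(i < N) (if i == j then f i else 0) *: e i.
    rewrite (bigD1 j) //= eqxx big1 ?addr0 // => i /negPf ->; exact: scale0r.
  rewrite combE -[RHS](linear0 H); congr (H _); apply: functional_extensionality_dep => i.
  rewrite /vec -[RHS]cyclic_proj0; apply/cyclic_projE; rewrite subr0.
  by case: ifP => _; [exists 1; rewrite mul1r|exists 0; rewrite mul0r].
move=> b; rewrite combE => b0 j; rewrite -[b j]subr0; apply/cyclic_projE.
rewrite cyclic_proj0 -[LHS]/(vec b j).
by rewrite -[vec b]HK b0 linear0.
Qed.

End ElementaryBasis.

(** * Homogeneous coefficients, relations and generators *)

Section HomogeneousCombinations.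
Variables (R : comNzRingType) (RG : nat -> set R).
Variables (M : lmodType R) (MG : nat -> set M).
Hypotheses (dR : internal_direct_sum RG) (gM : graded_module RG MG).

Let dM : internal_direct_sum MG := proj1 gM.

Lemma shift_grading0 k s : shift_grading k RG s 0.
Proof. by rewrite /shift_grading; case: ifP => // _; apply: (grading0 dR). Qed.

Lemma shift_gradingP k s (a : R) : a != 0 -> shift_grading k RG s a ->
  (k <= s)%N /\ RG (s - k)%N a.
Proof. by rewrite /shift_grading; case: leqP => // _ /eqP a0 /a0. Qed.

(** The part of [a] that, as coefficient of an element of degree [k], contributes to degree [s]. The
    test keeps the truncated [s - k] from selecting degree 0 when [s < k]. *)
Definition degree_part (a : R) (k s : nat) : R :=
  if (k <= s)%N then component dR a (s - k) else 0.

Lemma degree_part_in a k s : shift_grading k RG s (degree_part a k s).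
Proof.
by rewrite /shift_grading /degree_part; case: ifP => // _; apply: component_in.
Qed.

Lemma divides_degree_part f a k :
  (forall s, divides f (degree_part a k s)) -> divides f a.
Proof.
move=> fa; have [N [_ /(_ _ (leqnn N)) ->]] := component_sum dR a.
apply: (subgroup_sum (A := [set x | divides f x]%classic)).
  by case: (divides_ideal f).
by move=> i _; have := fa (i + k)%N; rewrite /degree_part leq_addl addnK.
Qed.

Lemma scale_shift k s a x : MG k x -> shift_grading k RG s a -> MG s (a *: x).
Proof.
move=> Mx; rewrite /shift_grading; case: leqP => [ks Ga|_ ->].
  by rewrite -(subnK ks); apply: (proj2 gM).
by rewrite scale0r; apply: (grading0 dM).
Qed.

Section Family.
Variables (I : finType) (n : I -> nat) (e : I -> M).
Hypothesis Ge : forall i, MG (n i) (e i).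

Lemma component_combination (b : I -> R) s :
  component dM (\sum_i b i *: e i) s = \sum_i degree_part (b i) (n i) s *: e i.
Proof.
rewrite component_big; apply: eq_bigr => i _.
rewrite (component_scale dR dM _ _ gM (Ge i)) /degree_part.
by case: ifP => //; rewrite scale0r.
Qed.

Lemma homogeneous_coefficients s x (b : I -> R) :
  MG s x -> x = \sum_i b i *: e i ->
  exists2 c : I -> R, forall i, shift_grading (n i) RG s (c i) & x = \sum_i c i *: e i.
Proof.
move=> Gx Ex; exists (fun i => degree_part (b i) (n i) s).
  by move=> i; apply: degree_part_in.
by rewrite -component_combination -Ex (component_id dM Gx).
Qed.

(** The degree parts of a relation form relations again, and divisibility by [f i] can be tested on
    them. *)
Lemma homogeneous_relations (f : I -> R) :
  (forall s (b : I -> R), (forall i, shift_grading (n i) RG s (b i)) ->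
     \sum_i b i *: e i = 0 -> forall i, divides (f i) (b i)) ->
  forall b : I -> R, \sum_i b i *: e i = 0 -> forall i, divides (f i) (b i).
Proof.
move=> rel b b0 i; apply: (divides_degree_part (k := n i)) => s.
apply: (rel s (fun j => degree_part (b j) (n j) s)) => [j|]; first exact: degree_part_in.
by rewrite -component_combination b0 component0.
Qed.

End Family.

(** The components of finitely many generators, up to a common degree bound [L], generate as well;
    they are indexed by pairs of a generator and a degree. *)
Lemma homogeneous_generators : finitely_generated M ->
  exists N (n : 'I_N -> nat) (e : 'I_N -> M),
    (forall j, MG (n j) (e j)) /\ generates e.
Proof.
move=> [k [e gen]].
have [L EL] : exists L, forall i, e i = \sum_(j < L) component dM (e i) j.
  have [h Eh] := choice (fun i => component_sum dM (e i)).
  exists (\max_i h i) => i; apply: (proj2 (Eh i)); exact: leq_bigmax.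
pose I := ('I_k * 'I_L)%type.
pose u (p : I) := component dM (e p.1) p.2.
exists #|{: I}|, (fun j => nat_of_ord (@enum_val I {: I} j).2),
  (fun j => u (@enum_val I {: I} j)).
split=> [j|x]; first exact: component_in.
have [c ->] := gen x; exists (fun j => c (@enum_val I {: I} j).1).
rewrite -(@big_enum_val _ _ +%R _ {: I}
  (fun p : I => c p.1 *: u p)) /=.
rewrite -(pair_bigA _ (fun i j => c i *: u (i, j))) /=.
by apply: eq_bigr => i _; rewrite {1}EL scaler_sumr.
Qed.

End HomogeneousCombinations.

(** * Uniqueness *)

Section Uniqueness.
Variables (R : idomainType) (RG : nat -> set R).
Variables (M : lmodType R) (MG : nat -> set M).
Hypotheses (gR : graded_ring RG) (gM : graded_module RG MG).
Hypothesis unit0 : forall a, RG 0%N a -> a != 0 -> a \is a GRing.unit.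

Let dR : internal_direct_sum RG := proj1 gR.

(** Over the fraction field the identity has rank [m], the product rank at most [n]. *)
Lemma mulmx1_leq (m n : nat) (A : 'M[R]_(m, n)) (B : 'M[R]_(n, m)) :
  A *m B = 1%:M -> (m <= n)%N.
Proof.
move=> /(congr1 (map_mx (@tofrac R))); rewrite map_mxM map_mx1 => AB.
rewrite -(mxrank1 {fraction R} m) -AB.
exact: leq_trans (mxrankM_maxl _ _) (rank_leq_col _).
Qed.

Lemma unit_divides_trans (f g a : R) : a \is a GRing.unit ->
  divides f (a * g) -> divides f g.
Proof. by move=> ua [c E]; exists (a^-1 * c); rewrite -mulrA -E mulKr. Qed.

Variables (N N' : nat) (n : 'I_N -> nat) (n' : 'I_N' -> nat).
Variables (f : 'I_N -> R) (f' : 'I_N' -> R) (e : 'I_N -> M) (e' : 'I_N' -> M).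
Hypotheses (be : elementary_basis MG n f e) (be' : elementary_basis MG n' f' e').
Hypothesis nu : forall j, f j \isn't a GRing.unit.

(* Writing the [e j] with [n j = d] through the [e' i] and back only involves
   the [e' i] with [n' i = d], as the transition coefficients are homogeneous
   of degrees [n j - n' i] and [n' i - n l]; moreover coefficients of degree 0
   are 0 or units, and [f j] kills [e j], so that [f' i] divides [f j] whenever
   [e' i] occurs. *)
Lemma leq_count_basis (D : pred R) d :
  (forall x y, divides x y -> D y -> D x) ->
  (#|[pred j | (n j == d) && D (f j)]| <= #|[pred i | (n' i == d) && D (f' i)]|)%N.
Proof.
move=> downD; set J := [pred j | _]; set J' := [pred i | _].
case: be => Ge gen fe rel; case: be' => Ge' gen' fe' rel'.
have ex_a j : exists a : 'I_N' -> R, (forall i, shift_grading (n' i) RG (n j) (a i))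
    /\ e j = \sum_(i < N') a i *: e' i.
  have [b Eb] := gen' (e j).
  by have [c Gc Ec] := homogeneous_coefficients dR gM Ge' (Ge j) Eb; exists c.
have ex_b i : exists b : 'I_N -> R, (forall j, shift_grading (n j) RG (n' i) (b j))
    /\ e' i = \sum_(j < N) b j *: e j.
  have [b Eb] := gen (e' i).
  by have [c Gc Ec] := homogeneous_coefficients dR gM Ge (Ge' i) Eb; exists c.
have [a Ea] := choice ex_a; have [b Eb] := choice ex_b.
(* Substituting one expansion into the other and subtracting [e j] gives a relation between the
   [e l]. *)
have ab j l : divides (f l) (\sum_(i < N') a j i * b i l - (l == j)%:R).
  apply: (rel (fun l => \sum_(i < N') a j i * b i l - (l == j)%:R)).
  under eq_bigr => k _ do rewrite scalerBl scaler_suml.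
  rewrite sumrB exchange_big /= [X in _ - X](bigD1 j) //= eqxx scale1r.
  rewrite [X in _ - (_ + X)]big1 ?addr0 => [|k /negPf ->]; last by rewrite scale0r.
  apply/eqP; rewrite subr_eq0 eq_sym {1}(proj2 (Ea j)); apply/eqP/eq_bigr => i _.
  by rewrite {1}(proj2 (Eb i)) scaler_sumr; apply: eq_bigr => k _; rewrite scalerA.
have occurs j i l : j \in J -> l \in J -> a j i * b i l != 0 ->
    i \in J' /\ RG 0%N (a j i * b i l).
  rewrite !inE => /andP[/eqP nj Dj] /andP[/eqP nl _].
  rewrite mulf_eq0 negb_or => /andP[a0 b0].
  have [nij Ga] := shift_gradingP a0 (proj1 (Ea j) i).
  have [nli Gb] := shift_gradingP b0 (proj1 (Eb i) l).
  have ni : n' i = d by apply/eqP; rewrite eqn_leq -{1}nj -nl nij nli.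
  move: Ga Gb; rewrite nj nl ni subnn => Ga Gb; split; last first.
    exact: (proj2 gR 0%N 0%N).
  rewrite eqxx /=; apply: downD Dj; apply: (unit_divides_trans (unit0 Ga a0)).
  rewrite mulrC; apply: (rel' (fun i => f j * a j i)).
  under eq_bigr => k _ do rewrite -scalerA.
  by rewrite -scaler_sumr -(proj2 (Ea j)).
pose A : 'M[R]_(#|J|, #|J'|) := \matrix_(p, q) a (enum_val p) (enum_val q).
pose B : 'M[R]_(#|J'|, #|J|) := \matrix_(q, p) b (enum_val q) (enum_val p).
apply: (@mulmx1_leq _ _ A B); apply/matrixP => p q; rewrite !mxE.
under eq_bigr => k _ do rewrite !mxE.
have Jp := enum_valP p; have Jq := enum_valP q.
set j := enum_val p; set l := enum_val q.
rewrite -(@big_enum_val _ _ +%R _ J' (fun i => a j i * b i l)) /=.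
have -> : \sum_(i in J') a j i * b i l = \sum_(i < N') a j i * b i l.
  rewrite [RHS](bigID (mem J')) /= [X in _ + X]big1 ?addr0 // => i iJ.
  apply/eqP; apply: contraR iJ => /(occurs _ _ _ Jp Jq)[]; by [].
have G0 : RG 0%N (\sum_(i < N') a j i * b i l).
  apply: subgroup_sum => [|i _]; first exact: (grading_subgroup dR).
  have [->|] := eqVneq (a j i * b i l) 0; first exact: (grading0 dR).
  by case/(occurs _ _ _ Jp Jq).
have -> : (p == q) = (l == j) by rewrite eq_sym (inj_eq enum_val_inj).
(* The difference has degree 0, so if nonzero it is a unit, and then so is its divisor [f l]. Hence
   the product is exactly the identity, not only modulo the divisors. *)
apply/eqP; rewrite -subr_eq0; apply: contraNT (nu l) => z0.
have [c Ec] := ab j l; suff : c * f l \is a GRing.unit by rewrite unitrM => /andP[].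
rewrite -Ec; apply: unit0 z0; apply: (proj2 (grading_subgroup dR 0%N)) => //.
by case: (l == j); [exact: grading1|exact: (grading0 dR)].
Qed.

End Uniqueness.

(** * Multiplicities in the signature *)

Section Signature.
Variable R : idomainType.

Lemma unit_class_id (f : R) : unit_class f f.
Proof. by exists 1; rewrite ?mul1r //=; apply: unitr1. Qed.

Lemma divides_unit_class_sub (f g : R) : divides f g -> divides g f ->
  (unit_class f `<=` unit_class g)%classic.
Proof.
move=> [a Ea] [b Eb] _ [u uu <-].
have [g0|g0] := eqVneq g 0.
  by rewrite Eb g0 !mulr0; exists 1; rewrite ?mulr0 //=; apply: unitr1.
have ub : b \is a GRing.unit.
  apply/unitrP; exists a; suff ab : a * b = 1 by split; rewrite // mulrC.
  by apply: (mulIf g0); rewrite -mulrA -Eb -Ea mul1r.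
by exists (u * b); [rewrite /= unitrM ub andbT|rewrite Eb mulrA].
Qed.

Lemma unit_class_eqP (f g : R) :
  unit_class f = unit_class g <-> divides f g /\ divides g f.
Proof.
split=> [E|[fg gf]]; last by apply/seteqP; split; apply: divides_unit_class_sub.
have [u _ Eu] : unit_class g f by rewrite -E; apply: unit_class_id.
have [v _ Ev] : unit_class f g by rewrite E; apply: unit_class_id.
by split; [exists v|exists u].
Qed.

(** Among the [f j] dividing [g], those divisible by [g] are the ones in its unit class. The
    additive form avoids truncated subtraction. *)
Lemma count_signature N (n : 'I_N -> nat) (f : 'I_N -> R) d g :
  (count_mem (d, unit_class g) [seq (n j, unit_class (f j)) | j <- enum 'I_N]
   + #|[pred j | (n j == d) && `[< divides (f j) g /\ ~ divides g (f j) >]]|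
   = #|[pred j | (n j == d) && `[< divides (f j) g >]]|)%N.
Proof.
set A := [pred j | _ && `[< divides (f j) g >]].
rewrite -(cardID [pred j | `[< divides g (f j) >]] A); congr (_ + _)%N.
  rewrite count_map -size_filter cardE [in RHS]/enum_mem -enumT.
  congr size; apply: eq_filter => j /=.
  rewrite !inE xpair_eqE -andbA; congr (_ && _).
  by apply/eqP/andP => [/unit_class_eqP[? ?]|[/asboolP ? /asboolP ?]];
    [split; apply/asboolP|apply/unit_class_eqP].
apply: eq_card => j; rewrite !inE andbCA; congr (_ && _).
by apply/asboolP/andP => [[? ?]|[/asboolP ? /asboolP ?]]; split=> //; apply/asboolP.
Qed.

End Signature.

(** * Existence *)

Section Existence.
Variables (R : idomainType) (RG : nat -> set R).
Variables (M : lmodType R) (MG : nat -> set M).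
Hypotheses (gR : graded_ring RG) (gM : graded_module RG MG).
Hypothesis quot : forall p r a b, RG p a -> a != 0 -> RG r b -> (p <= r)%N ->
  exists2 c, RG (r - p)%N c & b = c * a.

Let dR : internal_direct_sum RG := proj1 gR.

Definition homogeneous_relation N (n : 'I_N -> nat) (e : 'I_N -> M) s (b : 'I_N -> R) :=
  (forall j, shift_grading (n j) RG s (b j)) /\ \sum_(j < N) b j *: e j = 0.

(* Homogeneous generators whose first [m] members split off as direct
   summands [R / (f i)], with [f i] dividing all remaining relations. *)
Definition split_generators N m (n : 'I_N -> nat) (f : 'I_N -> R) (e : 'I_N -> M) :=
  [/\ (forall j, MG (n j) (e j)) /\ generates e,
      forall i : 'I_N, (i < m)%N -> homogeneous RG (f i) /\ f i *: e i = 0,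
      forall s b, homogeneous_relation n e s b ->
        forall i : 'I_N, (i < m)%N -> divides (f i) (b i),
      forall s b, homogeneous_relation n e s b ->
        (forall i : 'I_N, (i < m)%N -> b i = 0) ->
        forall i j : 'I_N, (i < m)%N -> divides (f i) (b j)
    & forall i j : 'I_N, (i < j)%N -> (j < m)%N -> divides (f i) (f j)].

Lemma homogeneous_relation_perm N (n : 'I_N -> nat) e s b (p : 'S_N) :
  homogeneous_relation (n \o p) (e \o p) s (b \o p) <-> homogeneous_relation n e s b.
Proof.
rewrite /homogeneous_relation [X in _ <-> (_ /\ X = _)](reindex_inj (@perm_inj _ p)) /=.
split=> -[Gb b0]; split=> // j.
by have := Gb (p^-1%g j); rewrite /= permKV.
Qed.

(** The divisors stay in place: only those with index below [m] are constrained, and [p] fixes these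
    indices. *)
Lemma split_generators_perm N m (n : 'I_N -> nat) f e (p : 'S_N) :
  (forall i : 'I_N, (i < m)%N -> p i = i) ->
  split_generators m n f e -> split_generators m (n \o p) f (e \o p).
Proof.
move=> fixp [[Ge gen] fe rel tail chain].
have fixpV (i : 'I_N) : (i < m)%N -> (p^-1)%g i = i.
  by move=> im; rewrite -{1}(fixp i im) permK.
have unperm (b : 'I_N -> R) : (b \o (p^-1)%g) \o p = b.
  by apply: funext => j /=; rewrite permK.
split=> //.
- split=> [j|x]; first exact: Ge.
  have [b ->] := gen x; exists (b \o p).
  by rewrite (reindex_inj (@perm_inj _ p)).
- by move=> i im /=; rewrite fixp //; apply: fe.
- move=> s b; rewrite -{1}(unperm b) homogeneous_relation_perm => hb i im.
  by have := rel _ _ hb i im; rewrite /= fixpV.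
move=> s b; rewrite -{1}(unperm b) homogeneous_relation_perm => hb b0 i j im.
have := tail _ _ hb _ i (p j) im; rewrite /= permK; apply => k km.
by rewrite fixpV // b0.
Qed.

(** In the split part each [b j] is a multiple of [f j], which kills [e j], so that part of the sum
    vanishes by itself. *)
Lemma relation_tail N m (n : 'I_N -> nat) f e s b :
  split_generators m n f e -> homogeneous_relation n e s b ->
  homogeneous_relation n e s (fun j : 'I_N => if (j < m)%N then 0 else b j).
Proof.
move=> [_ fe rel _ _] hb; split=> [j|].
  by case: ifP => // _; [exact: shift_grading0|case: hb].
case: (hb) => _ {2}<-; apply: eq_bigr => j _; case: ifP => // jm; rewrite scale0r.
have [a ->] := rel _ _ hb j jm.
by rewrite -scalerA (proj2 (fe j jm)) scaler0.
Qed.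

(** The remaining generators are free, so the next summand is a shifted copy of $R$ with divisor 0,
    which everything divides. *)
Lemma split_generators_torsion_free N m (n : 'I_N -> nat) f e : (m < N)%N ->
  split_generators m n f e ->
  (forall s b, homogeneous_relation n e s b ->
    (forall i : 'I_N, (i < m)%N -> b i = 0) -> forall i, b i = 0) ->
  split_generators m.+1 n (fun i => if (i < m)%N then f i else 0) e.
Proof.
move=> mN sg free; case: (sg) => [[Ge gen] fe rel tail chain].
have d0 (x : R) : divides x 0 by exists 0; rewrite mul0r.
split=> //.
- move=> i _; case: ifP => im; first exact: fe.
  by split; [exists 0%N; apply: (grading0 dR)|rewrite scale0r].
- move=> s b hb i _; case: ifP => im; first exact: (rel s).
  have := free _ _ (relation_tail sg hb) _ i; rewrite im => -> // k km.
  by rewrite km.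
- by move=> s b hb b0 i j _; rewrite (free s b hb) // => k /ltnW/b0.
- move=> i j ij jm; rewrite (leq_trans ij jm).
  by case: ifP => // jm'; apply: chain.
Qed.

(** The coefficient at [i] in a relation of degree [s'] has degree [s' - n i]. So the last
    hypothesis gives the pivot [a mo], of degree [k], the least degree among the nonzero
    coefficients of such relations, and by [quot] it divides them all. With [c = a / a mo], the
    element $\sum_j c_j e_j$ is killed by [a mo] and can replace [e mo] because [c mo = 1]. *)
Lemma split_generators_pivot N m (n : 'I_N -> nat) f e s a (mN : (m < N)%N) k :
  let mo := Ordinal mN in
  split_generators m n f e ->
  homogeneous_relation n e s a -> (forall i : 'I_N, (i < m)%N -> a i = 0) ->
  a mo != 0 -> (n mo + k)%N = s ->
  (forall s' b i, homogeneous_relation n e s' b ->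
    (forall i : 'I_N, (i < m)%N -> b i = 0) -> b i != 0 -> (n i + k <= s')%N) ->
  exists f' e', split_generators m.+1 n f' e'.
Proof.
move=> mo sg ha a0 am Ek kmin; case: (sg) => [[Ge gen] fe rel tail chain].
have Gam : RG k (a mo).
  by have [_] := shift_gradingP am (proj1 ha mo); rewrite -Ek addKn.
have pivot s' b i : homogeneous_relation n e s' b ->
    (forall i : 'I_N, (i < m)%N -> b i = 0) ->
    exists2 c, shift_grading (n i + k)%N RG s' c & b i = c * a mo.
  move=> hb b0; have [bi0|bi] := eqVneq (b i) 0.
    by exists 0; [exact: shift_grading0|rewrite mul0r].
  have [nis Gbi] := shift_gradingP bi (proj1 hb i).
  have le := kmin _ _ _ hb b0 bi.
  have [|c Gc ->] := quot Gam am Gbi; first by rewrite leq_subRL.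
  by exists c; rewrite // /shift_grading le subnDA.
(* These degrees of the quotients let the new generator keep the degree [n mo]. *)
have ex_c i : exists c, shift_grading (n i) RG (n mo) c /\ a i = c * a mo.
  have [c Gc Ec] := pivot s a i ha a0; exists c; split=> //.
  by move: Gc; rewrite -Ek /shift_grading leq_add2r subnDr.
have [c Ec] := choice ex_c.
have cm : c mo = 1 by apply: (mulIf am); rewrite mul1r -(proj2 (Ec mo)).
have c0 (i : 'I_N) : (i < m)%N -> c i = 0.
  move=> im; apply/eqP; move: (proj2 (Ec i)); rewrite a0 // => /esym/eqP.
  by rewrite mulf_eq0 (negPf am) orbF.
pose e' i := if i == mo then \sum_(j < N) c j *: e j else e i.
have em : a mo *: (\sum_(j < N) c j *: e j) = 0.
  rewrite scaler_sumr -[RHS](proj2 ha); apply: eq_bigr => j _.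
  by rewrite scalerA mulrC -(proj2 (Ec j)).
(* [T] converts coefficients with respect to [e'] into coefficients with respect to [e]; the first
   [m] stay unchanged, as [c] vanishes there. *)
pose T b : 'I_N -> R := fun j => if j == mo then b mo else b j + b mo * c j.
have TE b : \sum_(j < N) b j *: e' j = \sum_(j < N) T b j *: e j.
  rewrite (bigD1 mo) //= {1}/e' eqxx (bigD1 mo) //= cm scale1r scalerDr scaler_sumr.
  rewrite [RHS](bigD1 mo) //= {1}/T eqxx -addrA -big_split; congr (_ + _).
  by apply: eq_bigr => j /negPf jm; rewrite /= /e' /T jm scalerA -scalerDl addrC.
have hT s' b : homogeneous_relation n e' s' b -> homogeneous_relation n e s' (T b).
  move=> [Gb b0]; split; last by rewrite -TE.
  move=> j; rewrite /T; case: eqP => [->|_]; first exact: Gb.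
  move: (Gb mo) (Gb j) (proj1 (Ec j)).
  rewrite /shift_grading; case: (leqP (n mo) s') => [ms Gm|_ ->]; last first.
    by rewrite mul0r addr0.
  case: (leqP (n j) (n mo)) => [jm|mj Gj ->]; last by rewrite mulr0 addr0.
  rewrite (leq_trans jm ms) => Gj Gc; apply: subgroupD => //.
    exact: (grading_subgroup dR).
  have -> : (s' - n j = (s' - n mo) + (n mo - n j))%N by lia.
  exact: (proj2 gR).
have Tlt b (i : 'I_N) : (i < m)%N -> T b i = b i.
  by move=> im; rewrite /T c0 // mulr0 addr0; case: eqP im => // ->; rewrite ltnn.
have dpivot s' b i : homogeneous_relation n e s' b ->
    (forall i : 'I_N, (i < m)%N -> b i = 0) -> divides (a mo) (b i).
  by move=> hb b0; have [x _ ->] := pivot s' b i hb b0; exists x.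
exists (fun i => if i == mo then a mo else f i), e'.
have ltS (i : 'I_N) : (i < m.+1)%N -> i != mo -> (i < m)%N.
  by move=> im ne; rewrite ltn_neqAle -ltnS im andbT.
split.
- split=> [j|x].
    rewrite /e'; case: eqP => // ->; apply: subgroup_sum => [|i _].
      exact: (grading_subgroup (proj1 gM)).
    exact: (scale_shift gM (Ge i) (proj1 (Ec i))).
  have [b ->] := gen x; exists (fun j => if j == mo then b mo else b j - b mo * c j).
  rewrite TE; apply: eq_bigr => j _; rewrite /T eqxx.
  by case: eqP => [->|] //; rewrite subrK.
- move=> i im; rewrite /e'; case: eqP => [_|/eqP ne]; first by split=> //; exists k.
  exact/fe/ltS.
- move=> s' b /hT hb i im; case: eqP => [->|/eqP ne]; last first.
    by rewrite -(Tlt b) ?ltS //; apply: (rel s') => //; apply: ltS.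
  (* Clearing the first [m] coefficients of [T b] leaves a relation whose entry at [mo] is
     [b mo]. *)
  have := dpivot _ _ mo (relation_tail sg hb) _; rewrite /= ltnn /T eqxx; apply.
  by move=> j ->.
- move=> s' b hb b0; have bm : b mo = 0 by apply: b0; rewrite /=.
  have Tb : T b = b.
    by apply: funext => j; rewrite /T bm mul0r addr0; case: eqP => // ->.
  move: (hT _ _ hb); rewrite Tb => hb' i j im.
  have b0' (l : 'I_N) : (l < m)%N -> b l = 0 by move=> /ltnW/b0.
  case: eqP => [_|/eqP ne]; first exact: (dpivot s').
  by apply: (tail s') => //; apply: ltS.
move=> i j ij jm; have im : (i < m)%N by apply: leq_trans ij _.
have ne : i != mo by rewrite neq_ltn im.
(* The earlier divisors divide [a mo] since [a] is itself a relation vanishing below [m]. *)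
rewrite (negPf ne); case: eqP => [_|/eqP ne']; first exact: (tail s).
by apply: chain => //; apply: ltS.
Qed.

Lemma split_generators_step N m (n : 'I_N -> nat) f e : (m < N)%N ->
  split_generators m n f e -> exists n' f' e', @split_generators N m.+1 n' f' e'.
Proof.
move=> mN sg.
(* The minimum ranges over all families of length [N] split up to [m], not just the given one, so it
   still applies after the transposition that moves the pivot to position [m]. *)
pose pivot_degree k := `[< exists n f e s b i, [/\ @split_generators N m n f e,
  homogeneous_relation n e s b, forall i : 'I_N, (i < m)%N -> b i = 0, b i != 0
  & (n i + k)%N = s] >].
have [ex|nex] := pselect (exists k, pivot_degree k); last first.
  exists n, (fun i : 'I_N => if (i < m)%N then f i else 0), e.
  apply: (split_generators_torsion_free mN sg) => s b hb b0 i.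
  apply/eqP/negPn/negP => bi; apply: nex; exists (s - n i)%N; apply/asboolP.
  exists n, f, e, s, b, i; split=> //.
  by rewrite subnKC //; case: (shift_gradingP bi (proj1 hb i)).
case: (ex_minnP ex) => k /asboolP[n1 [f1 [e1 [s [a [i [sg1 ha a0 ai Es]]]]]]] kmin.
pose mo := Ordinal mN; pose p := tperm mo i.
have mi : (m <= i)%N by rewrite leqNgt; apply: contra ai => /a0 ->.
have fixp (l : 'I_N) : (l < m)%N -> p l = l.
  move=> lm; rewrite tpermD // -val_eqE /= ?gtn_eqF //.
  exact: leq_trans mi.
have sg2 := split_generators_perm fixp sg1.
exists (n1 \o p); apply: (@split_generators_pivot _ _ _ _ _ s (a \o p) mN k sg2).
- exact/homogeneous_relation_perm.
- by move=> l lm /=; rewrite fixp ?a0.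
- by rewrite /= tpermL.
- by rewrite /= tpermL.
move=> s' b j hb b0 bj; have [le _] := shift_gradingP bj (proj1 hb j).
rewrite -(subnKC le) leq_add2l; apply: kmin; apply/asboolP.
by exists (n1 \o p), f1, (e1 \o p), s', b, j; split=> //; rewrite subnKC.
Qed.

Lemma split_generators_full N (n : 'I_N -> nat) (e : 'I_N -> M) :
  (forall j, MG (n j) (e j)) -> generates e ->
  exists n' f' e', @split_generators N N n' f' e'.
Proof.
move=> Ge gen; suff : forall m, (m <= N)%N ->
  exists n' f' e', @split_generators N m n' f' e' by apply.
(* For [m = 0] the divisors are mere placeholders. *)
elim=> [_|m IH mN]; first by exists n, (fun=> 0), e; split.
have [n' [f' [e' sg]]] := IH (ltnW mN).
exact: split_generators_step sg.
Qed.

(** Splitting keeps the number of generators, so a minimal number stays minimal. A unit divisor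
    would make its generator zero, and dropping that one would contradict minimality. *)
Lemma exists_elementary_basis : RG 0%N 1 -> finitely_generated M ->
  exists N (n : 'I_N -> nat) f e, [/\ elementary_basis MG n f e,
    forall j, homogeneous RG (f j), forall i j : 'I_N, (i < j)%N -> divides (f i) (f j)
    & forall j, f j \isn't a GRing.unit].
Proof.
move=> RG1 fgM.
pose P N := `[< exists (n : 'I_N -> nat) (e : 'I_N -> M),
    (forall j, MG (n j) (e j)) /\ generates e >].
have ex : exists N, P N.
  have [N [n [e h]]] := homogeneous_generators gM fgM.
  by exists N; apply/asboolP; exists n, e.
case: (ex_minnP ex) => N /asboolP[n0 [e0 [Ge0 gen0]]] Nmin.
have [n [f [e [[Ge gen] fe rel tail chain]]]] := split_generators_full Ge0 gen0.
exists N, n, f, e; split.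
- split=> //; first by move=> j; case: (fe j (ltn_ord j)).
  apply: (homogeneous_relations dR gM Ge) => s b Gb b0 i.
  exact: (rel s).
- by move=> j; case: (fe j (ltn_ord j)).
- by move=> i j ij; apply: chain.
move=> j; apply/negP => uf.
have ej : e j = 0.
  by rewrite -[e j]scale1r -(mulVr uf) -scalerA (proj2 (fe j (ltn_ord j))) scaler0.
case: N j n e Ge gen ej Nmin {n0 e0 Ge0 gen0 f fe rel tail chain uf}
  => [[]//|N] j n e Ge gen ej /(_ N); rewrite ltnn => Nmin.
suff /Nmin : P N by [].
apply/asboolP; exists (n \o lift j), (e \o lift j); split=> [i|x]; first exact: Ge.
have [b ->] := gen x; exists (b \o lift j).
by rewrite (bigD1_ord j) //= ej scaler0 add0r.
Qed.

End Existence.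

Theorem theorem1p1 (R : idomainType) (RG : nat -> set R)
    (M : lmodType R) (MG : nat -> set M) :
  graded_PID RG ->
  RG 0%N <> [set: R]%classic ->
  graded_module RG MG ->
  finitely_generated M ->
  (exists d : graded_edd RG MG, edd_nonunit d) /\
  (forall d d' : graded_edd RG MG,
     edd_nonunit d -> edd_nonunit d' -> edd_signature d = edd_signature d').
Proof.
move=> pR RG0 gM fgM; have gR := proj1 pR; have dR := proj1 gR.
have RG1 := grading1 gR; have unit0 := degree0_unit pR RG0.
split.
  have [N [n [f [e [be hf chain nu]]]]] :=
    exists_elementary_basis gR gM (homogeneous_quotient pR RG0) RG1 fgM.
  have iso : graded_isomorphic MG (divisor_sum_grading RG n f).
    apply: (elementary_basis_iso _ gM be) => s x Gx; case: be => Ge gen _ _.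
    by have [b Eb] := gen x; apply: homogeneous_coefficients Gx Eb.
  have chainS (i j : 'I_N) : j = i.+1 :> nat -> divides (f i) (f j).
    by move=> ij; apply: chain; rewrite ij.
  by exists (GradedEdd hf chainS iso).
move=> d d' nu nu'.
have [e be] := iso_elementary_basis RG1 (grading0 dR) (edd_iso d).
have [e' be'] := iso_elementary_basis RG1 (grading0 dR) (edd_iso d').
have card_eq (D : pred R) k : (forall x y, divides x y -> D y -> D x) ->
    #|[pred j | (edd_degree d j == k) && D (edd_divisor d j)]|
    = #|[pred j | (edd_degree d' j == k) && D (edd_divisor d' j)]|.
  move=> downD; apply/eqP; rewrite eqn_leq; apply/andP; split.
    exact: (leq_count_basis gR gM unit0 be be' nu).
  exact: (leq_count_basis gR gM unit0 be' be nu').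
have divides_trans (x y z : R) : divides x y -> divides y z -> divides x z.
  by move=> [a ->] [b ->]; exists (b * a); rewrite mulrA.
have count_eq k g :
    count_mem (k, unit_class g)
      [seq (edd_degree d j, unit_class (edd_divisor d j)) | j <- enum 'I_(edd_size d)] =
    count_mem (k, unit_class g)
      [seq (edd_degree d' j, unit_class (edd_divisor d' j)) | j <- enum 'I_(edd_size d')].
  (* The number of strict divisors of [g], equal for both decompositions, is added to bring in
     [count_signature]. *)
  apply: (@addIn #|[pred j | (edd_degree d j == k) &&
    `[< divides (edd_divisor d j) g /\ ~ divides g (edd_divisor d j) >]]|).
  rewrite count_signature (card_eq (fun x => `[< divides x g /\ ~ divides g x >])).
    rewrite count_signature; apply: (card_eq (fun x => `[< divides x g >])).
    by move=> x y xy /asboolP yg; apply/asboolP/(divides_trans _ _ _ xy yg).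
  move=> x y xy /asboolP[yg ngy]; apply/asboolP; split; first exact: divides_trans yg.
  by move=> gx; apply: ngy; apply: divides_trans xy.
apply/eq_seq_msetP/allP => z; rewrite mem_cat => /orP[] /mapP[j _ ->] /=;
  by apply/eqP; apply: count_eq.
Qed.
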